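(* For $T>0$ and $k>0$ let $$\widetilde I_T(k)=\frac12\inf_{f\in\mathbb H_0^1}\left[\frac{k^2}{\int_0^T\exp\{-t+2f(t)\}dt}+\int_0^T\dot f(t)^2dt\right].$$ Then, for all $T>0$ and $0<k<\sqrt{\frac{1-e^{-T}}{2Te}}$, $$\frac{k^2(e-1)}{2e(1-e^{-T})}\le\widetilde I_T(k)\le\frac{k^2}{1-e^{-T}}.$$
   Context: $\mathbb H_0^1$ is the set of absolutely continuous $f:[0,T]\to\mathbb R$ with $f(0)=0$ and $\dot f\in L^2[0,T]$. $\widetilde I_T$ is the rate function of the toy model $dS_t=X_tS_tdW_t$, $dX_t=X_tdB_t$, $S_0=X_0=1$, with $W,B$ independent standard Brownian motions. *)

(* Defs.v *)
From HB Require Import structures.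
From mathcomp Require Import all_boot all_order all_algebra.
From mathcomp Require Import all_classical all_reals all_analysis.

Set Implicit Arguments.
Unset Strict Implicit.
Unset Printing Implicit Defensive.

Import Order.TTheory GRing.Theory Num.Theory.
Import numFieldNormedType.Exports.

Local Open Scope classical_set_scope.
Local Open Scope ring_scope.

(* Functions [0, T] -> R are represented by total functions R -> R. Nothing
   below depends on the values outside [0, T]: these only affect derive1 f at
   0 and T and outside [0, T]. *)

Definition absolutely_continuous_on (R : realType) (a b : R) (f : R -> R) :
    Prop :=
  forall eps : R, 0 < eps -> exists2 delta : R, 0 < delta &
    forall (n : nat) (u v : 'I_n -> R),
      (forall i, [/\ a <= u i, u i <= v i & v i <= b]) ->
      trivIset [set: 'I_n] (fun i => `]u i, v i[%classic) ->
      \sum_(i < n) (v i - u i) < delta ->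
      \sum_(i < n) `|f (v i) - f (u i)| < eps.

(* An absolutely continuous f is differentiable almost everywhere on [0, T];
   at the remaining points derive1 f takes a default value, which is irrelevant
   to its integrals. *)
Definition H01 (R : realType) (T : R) : set (R -> R) :=
  [set f | [/\ absolutely_continuous_on 0 T f,
               f 0 = 0 &
               ((derive1 f : R -> R) \_ `[0, T]) \in
                 Lfun (@lebesgue_measure R) (2%:R)%:E]].

Definition rate_functional (R : realType) (T k : R) (f : R -> R) : R :=
  k ^+ 2 / (\int[@lebesgue_measure R]_(t in `[0, T]) expR (- t + 2 * f t))
  + \int[@lebesgue_measure R]_(t in `[0, T]) (derive1 f t) ^+ 2.

(* For 0 < T the set of values is nonempty (f = 0) and bounded below by 0, so
   the real-valued [inf] is the genuine infimum. *)
Definition toy_rate (R : realType) (T k : R) : R :=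
  2^-1 * inf [set rate_functional T k f | f in H01 T].

(* Main.v *)
Require Import Defs.
From HB Require Import structures.
From mathcomp Require Import all_boot all_order all_algebra.
From mathcomp Require Import all_classical all_reals all_analysis.
From mathcomp Require Import measurable_realfun ring lra.

Import Order.TTheory GRing.Theory Num.Theory.
Import numFieldNormedType.Exports.

Local Open Scope classical_set_scope.
Local Open Scope ring_scope.

(* The upper bound is the value at f = 0. For the lower bound let
   a = k^2 / (1 - e^-T) and let E be the integral of f'^2. Since
   2 |f'| <= f'^2 / a + a, integrating from 0 gives 2 |f| <= M := E / a + a T,
   so the first term of the functional is at least a e^-M >= a (1 - M), and the
   functional is at least a (1 - M) + E = a (1 - a T). The hypothesis on k says
   a T < 1 / (2 e).
   Integrating f' requires Lebesgue's fundamental theorem of calculus for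
   absolutely continuous f: the variation V of f is again absolutely continuous,
   so f = V - (V - f) is a difference of nondecreasing absolutely continuous
   functions; the Stieltjes measure of such a function is dominated by the
   Lebesgue measure, its Radon-Nikodym density integrates back to the function,
   and by Lebesgue differentiation the density equals f' almost everywhere. *)

(** * Absolute continuity of the variation *)

Section interval_lists.
Context {R : realType}.
Implicit Types (p q : R * R) (l : seq (R * R)) (f : R -> R).

(* Equivalent to emptiness of the intersection of the two open intervals, also
   when one of them is degenerate. *)
Definition nonoverlapping p q := Num.min p.2 q.2 <= Num.max p.1 q.1.

Definition itv_in (a b : R) p := [&& a <= p.1, p.1 <= p.2 & p.2 <= b].

Definition total_length l := \sum_(p <- l) (p.2 - p.1).

Definition increments f l := \sum_(p <- l) `|f p.2 - f p.1|.

Lemma nonoverlapping_sub p p' q q' : p.1 <= p'.1 -> p'.2 <= p.2 ->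
  q.1 <= q'.1 -> q'.2 <= q.2 -> nonoverlapping p q -> nonoverlapping p' q'.
Proof.
move=> h1 h2 h3 h4; rewrite /nonoverlapping => h.
apply: (le_trans (le_min2 h2 h4)); apply: (le_trans h).
exact: le_max2.
Qed.

Lemma nonoverlapping_setI0 p q : nonoverlapping p q ->
  `]p.1, p.2[%classic `&` `]q.1, q.2[%classic = set0.
Proof.
rewrite /nonoverlapping => h; apply/seteqP; split => // x [] /=.
rewrite !in_itv /= => /andP[p1 p2] /andP[q1 q2].
have : Num.max p.1 q.1 < x by rewrite gt_max p1 q1.
have : x < Num.min p.2 q.2 by rewrite lt_min p2 q2.
by move=> /lt_le_trans/(_ h)/lt_trans h' /h'; rewrite ltxx.
Qed.

(** Lists replace families indexed by ['I_n] because partitions get concatenated, mapped and built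
    by induction. Adjacent cells of a partition qualify, since [nonoverlapping] tolerates a common
    endpoint. *)
Definition abs_cont (a b : R) f := forall e : R, 0 < e -> exists2 d : R, 0 < d &
  forall l, all (itv_in a b) l -> pairwise nonoverlapping l ->
    total_length l < d -> increments f l < e.

Lemma absolutely_continuous_on_abs_cont a b f :
  absolutely_continuous_on a b f -> abs_cont a b f.
Proof.
move=> acf e e0; have [d d0 H] := acf e e0; exists d => // l lab lno ld.
pose u (i : 'I_(size l)) := (nth (0, 0) l i).1.
pose v (i : 'I_(size l)) := (nth (0, 0) l i).2.
have := H (size l) u v; rewrite /increments (big_nth (0, 0)) big_mkord; apply.
- by move=> i; have /and3P[] := allP lab _ (mem_nth (0, 0) (ltn_ord i)).
- move=> i j _ _; rewrite /u /v => ij0; apply/val_inj/eqP => /=.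
  apply/negP => /negP; rewrite neq_ltn.
  have /(pairwiseP (0, 0)) lno' := lno.
  move: ij0 => /set0P/eqP ij0.
  move=> /orP[|] ij; apply: ij0; [|rewrite setIC];
    by apply: nonoverlapping_setI0; apply: lno'; rewrite ?inE.
- by move: ld; rewrite /total_length (big_nth (0, 0)) big_mkord.
Qed.

(** The points [s] of an [itv_partition a b s] do not include [a], so it is prepended to form the
    consecutive cells. *)
Definition partition_pairs (a : R) (s : seq R) := zip (a :: s) s.

(** Makes [abs_cont] applicable to variation sums. The lengths telescope, and every later cell
    starts at or after the right end of the first. *)
Lemma partition_pairsP a b s : itv_partition a b s ->
  [/\ all (itv_in a b) (partition_pairs a s),
      pairwise nonoverlapping (partition_pairs a s),
      total_length (partition_pairs a s) = b - a &
      forall f, increments f (partition_pairs a s) = variation a b f s].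
Proof.
move=> abs.
suff [h1 h2 h3] : [/\ all (itv_in a b) (partition_pairs a s),
      pairwise nonoverlapping (partition_pairs a s) &
      total_length (partition_pairs a s) = b - a].
  split => // f; rewrite variation_zip// /increments /partition_pairs.
  elim: s (a) {abs h1 h2 h3} => [|x s IH] c; first by rewrite /= !big_nil.
  by rewrite /= !big_cons /= IH.
elim: s a abs => [|x s IH] a abs.
  by case: abs => /= _ /eqP ->; rewrite /total_length /= big_nil subrr.
have xbs : itv_partition x b s by case: abs => /= /andP[_ xs] sb.
have ax : a <= x by case: abs => /= /andP[/ltW].
have xb : x <= b := itv_partition_le xbs.
have [h1 h2 h3] := IH _ xbs; split.
- rewrite /partition_pairs /= /itv_in /= lexx ax xb /=.
  apply: sub_all h1 => p /and3P[p1 p2 p3]; apply/and3P; split => //.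
  exact: le_trans p1.
- rewrite /partition_pairs /= h2 andbT; apply: sub_all h1 => p /and3P[p1 p2 p3].
  by rewrite /nonoverlapping /= ge_min le_max p1 orbT.
- rewrite /total_length /partition_pairs /= big_cons /=.
  by rewrite -[X in _ + X]/(total_length _) h3; ring.
Qed.

(** A partition of a subinterval shorter than [d] is itself an admissible list, so each of its
    variation sums is below 1, and the supremum is at most 1. *)
Lemma abs_cont_TV_le1 a b f : abs_cont a b f -> exists2 d : R, 0 < d &
  forall u v, a <= u -> u <= v -> v <= b -> v - u < d ->
    (total_variation u v f <= 1)%E.
Proof.
move=> acf; have [d d0 H] := acf 1 ltr01; exists d => // u v au uv vb uvd.
apply: ge_ereal_sup => _ [_ [s uvs <-] <-]; rewrite lee_fin ltW//.
have [h1 h2 h3 <-] := partition_pairsP _ _ _ uvs; apply: H => //.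
- apply: sub_all h1 => p /and3P[p1 p2 p3]; apply/and3P; split => //.
    exact: le_trans p1.
  exact: le_trans vb.
- by rewrite h3.
Qed.

(** Cut [[a, b]] into [N] pieces of variation at most 1 each; additivity bounds the total variation
    by [N]. *)
Lemma abs_cont_bounded_variation a b f : a <= b -> abs_cont a b f ->
  bounded_variation a b f.
Proof.
move=> ab acf; apply/bounded_variationP => //.
rewrite ge0_fin_numE; last exact: total_variation_ge0.
have [d d0 H] := abs_cont_TV_le1 _ _ _ acf.
(* This is the number of equal pieces; the successor makes the mesh strictly smaller than [d]. *)
pose N := (Num.truncn ((b - a) / d)).+1.
have N0 : 0 < N%:R :> R by rewrite ltr0n.
have Nd : (b - a) / N%:R < d.
  rewrite ltr_pdivrMr// mulrC -ltr_pdivrMr//.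
  by rewrite /N truncnS_gt.
pose x (i : nat) := a + (b - a) / N%:R * i%:R.
have ba0 : 0 <= (b - a) / N%:R by rewrite divr_ge0// subr_ge0.
have xN : x N = b by rewrite /x divfK ?gt_eqF// addrC subrK.
have xle i : x i <= x i.+1.
  by rewrite /x lerD2l ler_wpM2l// ler_nat.
have xa i : a <= x i by rewrite /x lerDl mulr_ge0.
have xb i : (i <= N)%N -> x i <= b.
  by move=> iN; rewrite -xN /x lerD2l ler_wpM2l// ler_nat.
suff : forall i, (i <= N)%N -> (total_variation a (x i) f <= i%:R%:E)%E.
  by move=> /(_ N (leqnn _)); rewrite xN => /le_lt_trans; apply; rewrite ltry.
elim => [_|i IH iN].
  by rewrite /x mulr0 addr0 total_variationxx.
rewrite (total_variationD _ (xa i) (xle i)) -natr1 EFinD.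
apply: leeD; first exact/IH/ltnW.
apply: (H _ _ (xa i) (xle i) (xb _ iN)).
by rewrite [X in X < _](_ : _ = (b - a) / N%:R)// /x -natr1; ring.
Qed.

(** Each interval of [l] is replaced by a partition whose variation sum is within [e] of the
    supremum. The last conjunct is the invariant of the induction: it locates the cells of [l'], so
    that new cells cannot overlap them. *)
Lemma refine_increments a b f l e : abs_cont a b f -> 0 < e ->
  all (itv_in a b) l -> pairwise nonoverlapping l ->
  exists l', [/\ all (itv_in a b) l', pairwise nonoverlapping l',
    total_length l' = total_length l,
    \sum_(p <- l) fine (total_variation p.1 p.2 f) <=
      increments f l' + e *+ size l &
    all (fun p' => has (fun p => itv_in p.1 p.2 p') l) l'].
Proof.
move=> acf e0; elim: l => [_ _|p l IH /= /andP[pab lab] /andP[pl lno]].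
  by exists [::]; split => //; rewrite /increments !big_nil mulr0n addr0.
have [l' [h1 h2 h3 h4 h5]] := IH lab lno.
have /and3P[p1 p12 p2] := pab.
have acp : abs_cont p.1 p.2 f.
  move=> e1 e10; have [d d0 H] := acf _ e10; exists d => // l0 H1; apply: H.
  apply: sub_all H1 => q /and3P[q1 q2 q3]; apply/and3P; split => //.
    exact: le_trans q1.
  exact: le_trans p2.
have TVfin : total_variation p.1 p.2 f \is a fin_num.
  exact/bounded_variationP/abs_cont_bounded_variation.
have [s ps Hs] : exists2 s, itv_partition p.1 p.2 s &
    fine (total_variation p.1 p.2 f) - e < variation p.1 p.2 f s.
  have : ((fine (total_variation p.1 p.2 f) - e)%:E <
          total_variation p.1 p.2 f)%E.
    by rewrite -[in ltRHS](fineK TVfin) lte_fin ltrBlDr ltrDl.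
  move=> /ereal_sup_gt[_ [_ [s ps <-] <-]]; rewrite lte_fin => Hs.
  by exists s.
have [g1 g2 g3 g4] := partition_pairsP _ _ _ ps.
exists (partition_pairs p.1 s ++ l'); split.
- rewrite all_cat h1 andbT; apply: sub_all g1 => q /and3P[q1 q2 q3].
  apply/and3P; split => //; first exact: le_trans q1.
  exact: le_trans p2.
(* A new cell [q] lies in [p] and an old cell [q'] in some [r] of [l]; [p] and [r] do not overlap,
   hence neither do [q] and [q']. *)
- rewrite pairwise_cat g2 h2 !andbT; apply/allrelP => q q' qs q'l'.
  have /and3P[q1 q12 q2] := allP g1 _ qs.
  have /hasP[r rl /and3P[r1 r12 r2]] := allP h5 _ q'l'.
  exact: (nonoverlapping_sub p q r q') (allP pl _ rl).
- by rewrite /total_length big_cat big_cons /=; congr (_ + _).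
- rewrite /increments big_cat big_cons /= mulrS addrACA.
  apply: lerD => //; rewrite -lerBlDr; apply/ltW.
  by rewrite -[ltRHS]/(increments f _) g4.
- rewrite all_cat; apply/andP; split.
    by apply: sub_all g1 => q ->.
  by apply: sub_all h5 => q ->; rewrite orbT.
Qed.

Definition variation_fun (a : R) f (x : R) := fine (total_variation a x f).

(** Additivity of the total variation; bounded variation makes both summands finite, so [fine]
    preserves the sum. *)
Lemma variation_funB a b f u v : abs_cont a b f -> a <= u -> u <= v -> v <= b ->
  variation_fun a f v - variation_fun a f u = fine (total_variation u v f).
Proof.
move=> acf au uv vb; have ab : a <= b by lra.
have bv := abs_cont_bounded_variation _ _ _ ab acf.
have bvv : bounded_variation a v f by apply: bounded_variationl bv => //; lra.
rewrite /variation_fun (total_variationD _ au uv) fineD; first by ring.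
  by apply/bounded_variationP => //; apply: bounded_variationl bvv.
by apply/bounded_variationP => //; apply: bounded_variationr bvv.
Qed.

(** Refining preserves total length, so the [d] that serves [f] for [e / 2] also bounds the
    increments over the refined list; the refinement error takes the other half. *)
Lemma abs_cont_variation_fun a b f : abs_cont a b f ->
  abs_cont a b (variation_fun a f).
Proof.
move=> acf e e0; have e20 : 0 < e / 2 by lra.
have [d d0 H] := acf _ e20; exists d => // l lab lno ld.
(* The error [e / 2] is shared among the intervals; the successor keeps the divisor positive when
   [l] is empty. *)
have n0 : 0 < (size l).+1%:R :> R by rewrite ltr0n.
have [l' [h1 h2 h3 h4 _]] :=
  refine_increments a b f l (e / 2 / (size l).+1%:R) acf (divr_gt0 e20 n0) lab lno.
rewrite (_ : increments _ l =
    \sum_(p <- l) fine (total_variation p.1 p.2 f)); last first.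
  rewrite /increments big_seq [RHS]big_seq; apply: eq_bigr => p /(allP lab).
  move=> /and3P[p1 p2 p3]; rewrite (variation_funB _ b)// ger0_norm//.
  exact/fine_ge0/total_variation_ge0.
apply: (le_lt_trans h4); rewrite [ltRHS](splitr e).
have h5 : e / 2 / (size l).+1%:R *+ size l <= e / 2.
  by rewrite -mulr_natr mulrAC ler_pdivrMr// ler_pM2l// ler_nat leqnSn.
by apply: ltr_leD h5; apply: H; rewrite ?h3.
Qed.

Lemma abs_contB a b f g : abs_cont a b f -> abs_cont a b g ->
  abs_cont a b (f \- g).
Proof.
move=> acf acg e e0; have e20 : 0 < e / 2 by lra.
have [d d0 H] := acf _ e20; have [d' d'0 H'] := acg _ e20.
exists (Num.min d d'); first by rewrite lt_min d0 d'0.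
move=> l lab lno; rewrite lt_min => /andP[ld ld'].
have := H _ lab lno ld; have := H' _ lab lno ld'.
suff : increments (f \- g) l <= increments f l + increments g l by lra.
rewrite /increments -big_split /=; apply: ler_sum => p _.
rewrite (_ : (f \- g) p.2 - (f \- g) p.1 =
    (f p.2 - f p.1) - (g p.2 - g p.1)); last by rewrite /=; ring.
exact: ler_normB.
Qed.

Lemma variation_fun_nondecreasing a b f : abs_cont a b f ->
  {in `[a, b] &, nondecreasing_fun (variation_fun a f)}.
Proof.
move=> acf x y; rewrite !in_itv /= => /andP[ax xb] /andP[ay yb] xy.
rewrite -subr_ge0 (variation_funB _ b)//; exact/fine_ge0/total_variation_ge0.
Qed.

(** An increment of [f] never exceeds the variation over the same interval. *)
Lemma variation_funB_nondecreasing a b f : abs_cont a b f ->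
  {in `[a, b] &, nondecreasing_fun (variation_fun a f \- f)}.
Proof.
move=> acf x y; rewrite !in_itv /= => /andP[ax xb] /andP[ay yb] xy.
rewrite -subr_ge0 (_ : (variation_fun a f \- f) y - (variation_fun a f \- f) x =
    (variation_fun a f y - variation_fun a f x) - (f y - f x));
  last by rewrite /=; ring.
rewrite (variation_funB _ b)// subr_ge0 -lee_fin fineK.
  by apply: le_trans (total_variation_ge f xy); rewrite lee_fin ler_norm.
apply/bounded_variationP => //.
apply: (bounded_variationr ax) => //.
apply: (bounded_variationl ay yb).
apply: abs_cont_bounded_variation => //; lra.
Qed.

End interval_lists.

(** * Stieltjes measures dominated by the Lebesgue measure *)

Section stieltjes.
Context {R : realType}.
Notation mu := (@lebesgue_measure R).

Lemma setI0_nonoverlapping (p q : R * R) :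
  `]p.1, p.2[%classic `&` `]q.1, q.2[%classic = set0 -> nonoverlapping p q.
Proof.
rewrite /nonoverlapping => pq; rewrite leNgt; apply/negP => h.
(* The midpoint between the larger left end and the smaller right end would lie in both
   intervals. *)
suff : (set0 : set R) ((Num.max p.1 q.1 + Num.min p.2 q.2) / 2) by [].
rewrite -pq; move: h; rewrite gt_max !lt_min => /andP[/andP[h1 h2] /andP[h3 h4]].
split; rewrite /= in_itv /=; apply/andP; split;
  rewrite ?ltr_pdivlMr// ?ltr_pdivrMr//;
  case: (leP p.1 q.1); case: (leP p.2 q.2); lra.
Qed.

(** Case analysis on the endpoints: a bounded open interval equals its interior, a ray or the line
    has infinite measure, and all other combinations are empty. *)
Lemma open_interval_finite_measure (I : set R) : open I -> is_interval I ->
  (mu I < +oo)%E -> exists p : R * R, p.1 <= p.2 /\ I = `]p.1, p.2[%classic.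
Proof.
move=> oI /is_intervalP.
have E0 (J : set R) : (forall z, ~ J z) ->
    exists p : R * R, p.1 <= p.2 /\ J = `]p.1, p.2[%classic.
  by move=> J0; exists (0, 0); split => //=; rewrite set_itvoo0 -subset0 => z /J0.
case: (Rhull I) => -[b1 x|[|]] [b2 y|[|]] IE muI.
- have [xy|yx] := leP x y.
    exists (x, y); split => //=.
    by rewrite -(interior_itv_bnd x y b1 b2) -IE; apply/esym/interior_id.
  apply: E0 => z; rewrite IE /= in_itv; case: b1 b2 {IE} => -[] /= /andP[]; lra.
- by apply: E0 => z; rewrite IE /= in_itv /= ?andbF.
- by move: muI; rewrite IE lebesgue_measure_itv /= ltry.
- by move: muI; rewrite IE lebesgue_measure_itv /= ltNyr.
- by apply: E0 => z; rewrite IE /= in_itv /= ?andbF.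
- by move: muI; rewrite IE lebesgue_measure_itv /=.
- by apply: E0 => z; rewrite IE /= in_itv /= ?andbF.
- by apply: E0 => z; rewrite IE /= in_itv /= ?andbF.
- by apply: E0 => z; rewrite IE /= in_itv /= ?andbF.
Qed.

Lemma lebesgue_stieltjes_itvoc (h : cumulative R R) (x y : R) : x <= y ->
  lebesgue_stieltjes_measure h `]x, y]%classic = (h y - h x)%:E.
Proof.
move=> xy; rewrite /lebesgue_stieltjes_measure /measure_extension /=.
rewrite measurable_mu_extE/=; last exact: is_ocitv.
by rewrite wlength_itv_bnd.
Qed.

(** Outer regularity encloses a null set in an open [U] of measure below [d]. Any finitely many
    components of [U] have total length below [d], hence Stieltjes mass below [e]; the bound passes
    to the limit of the partial sums. *)
Lemma lebesgue_stieltjes_dominates (h : cumulative R R) :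
  (forall e : R, 0 < e -> exists2 d : R, 0 < d &
    forall l : seq (R * R), all (fun p => p.1 <= p.2) l ->
      pairwise nonoverlapping l -> total_length l < d -> increments h l < e) ->
  lebesgue_stieltjes_measure h `<< mu.
Proof.
move=> ach; set nu := lebesgue_stieltjes_measure h.
apply/null_content_dominatesP => A mA A0.
apply/eqP; rewrite eq_le measure_ge0 andbT; apply/lee_addgt0Pr => e e0.
rewrite add0e; have [d d0 H] := ach e e0.
have [|U [oU AU UA]] := lebesgue_regularity_outer mA _ d0; first by rewrite A0 ltry.
have mU : measurable (U : set (measurableTypeR R)) by exact: open_measurable.
have muU : (mu U < d%:E)%E.
  rewrite -(setDUK AU) measureU//=; [|exact: measurableD|exact: setDIK].
  by rewrite [X in (X + _)%E]A0 add0e.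
pose I := open_disjoint_itv oU.
have oI i : open (I i) by exact: open_disjoint_itv_open.
have mI i : measurable (I i : set (measurableTypeR R)) by exact: open_measurable.
have UI : U = \bigcup_i I i by exact: open_disjoint_itv_bigcup.
have tI : trivIset setT I by exact: open_disjoint_itv_trivIset.
have muI i : (mu (I i) < +oo)%E.
  rewrite (@le_lt_trans _ _ (mu U))//; last by rewrite (lt_trans muU)// ltry.
  apply: le_measure; rewrite ?inE//.
  by rewrite UI; exact: bigcup_sup.
have /choice[p /all_and2[p12 Ip]] : forall i, exists p : R * R,
    p.1 <= p.2 /\ I i = `]p.1, p.2[%classic.
  move=> i; apply: open_interval_finite_measure => //.
  exact: open_disjoint_itv_is_interval.
apply: (@le_trans _ _ (nu U)); first by rewrite le_measure ?inE.
have measureU (m : {measure set (measurableTypeR R) -> \bar R}) :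
    m U = (\sum_(i <oo) m (I i))%E.
  by rewrite UI; apply: measure_semi_bigcup => //; rewrite -UI.
rewrite [leLHS](measureU (lebesgue_stieltjes_measure h)).
apply: lime_le; first by apply: is_cvg_nneseries => *; exact: measure_ge0.
apply: nearW => n; pose l := [seq p i | i <- index_iota 0 n].
(* The mass is known exactly on half-open intervals, and enlarging the open component to one
   suffices for an upper bound. *)
have nuI i : (nu (I i) <= `|h (p i).2 - h (p i).1|%:E)%E.
  apply: (@le_trans _ _ (nu `](p i).1, (p i).2]%classic)).
    rewrite le_measure ?inE// Ip; exact: subset_itv_oo_oc.
  by rewrite /nu lebesgue_stieltjes_itvoc// lee_fin ler_norm.
apply: (@le_trans _ _ (increments h l)%:E).
  rewrite /increments big_map -sumEFin; exact: lee_sum.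
rewrite lee_fin ltW//; apply: H.
- by apply/allP => _ /mapP[i _ ->].
- rewrite pairwise_map; apply/(pairwiseP 0%N) => i j.
  rewrite !inE size_iota subn0 => i0 j0 ij; apply: setI0_nonoverlapping.
  rewrite -!Ip !nth_iota ?subn0// !add0n; apply/eqP/negPn/negP => /eqP/eqP/set0P.
  by move=> /(tI _ _ Logic.I Logic.I) ijE; rewrite ijE ltnn in ij.
- rewrite -lte_fin; apply: le_lt_trans muU; rewrite [leRHS](measureU mu).
  rewrite /total_length big_map -sumEFin.
  rewrite (eq_bigr (fun i => mu (I i))); first exact: nneseries_lim_ge.
  move=> i _; rewrite Ip lebesgue_measure_itv /= lte_fin.
  case: ltP => // h'; congr EFin; have := p12 i; lra.
Qed.

End stieltjes.

(** * The density of an absolutely continuous function *)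

Section density.
Context {R : realType}.
Notation mu := (@lebesgue_measure R).

(* Composition with clamp extends a function on [a, b] to the whole line by
   constants, as needed for a Stieltjes measure. *)
Definition clamp (a b x : R) := Num.max a (Num.min b x).

Lemma clamp_in a b x : a <= b -> a <= clamp a b x <= b.
Proof. by move=> ab; rewrite /clamp le_max lexx /= ge_max ab ge_min lexx. Qed.

Lemma clamp_id a b x : a <= x -> x <= b -> clamp a b x = x.
Proof. by move=> ax xb; rewrite /clamp min_r// max_r. Qed.

Lemma clamp_homo a b : {homo clamp a b : x y / x <= y}.
Proof. by move=> x y xy; rewrite /clamp; apply: le_max2 => //; exact: le_min2. Qed.

Lemma clamp_lipschitz a b x y : x <= y -> clamp a b y - clamp a b x <= y - x.
Proof.
rewrite /clamp => xy; case: (leP b x) => bx; case: (leP b y) => yb;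
  case: (leP a b) => ab; case: (leP a x) => ax; case: (leP a y) => ay; lra.
Qed.

(** Clamping is monotone, so it preserves nonoverlapping, and it lengthens no interval: the clamped
    list is admissible for the same [d]. *)
Lemma abs_cont_clamp a b (f : R -> R) : a <= b -> abs_cont a b f ->
  forall e : R, 0 < e -> exists2 d : R, 0 < d &
    forall l : seq (R * R), all (fun p => p.1 <= p.2) l ->
      pairwise nonoverlapping l -> total_length l < d ->
      increments (f \o clamp a b) l < e.
Proof.
move=> ab acf e e0; have [d d0 H] := acf e e0; exists d => // l l12 lno ld.
pose c (p : R * R) := (clamp a b p.1, clamp a b p.2).
have -> : increments (f \o clamp a b) l = increments f (map c l).
  by rewrite /increments big_map.
apply: H.
- rewrite all_map; apply: sub_all l12 => p p12; rewrite /itv_in /=.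
  have /andP[-> _] := clamp_in _ _ p.1 ab; have /andP[_ ->] := clamp_in _ _ p.2 ab.
  by rewrite clamp_homo.
- rewrite pairwise_map; apply: sub_pairwise lno => p q.
  rewrite /nonoverlapping /= => /(clamp_homo a b).
  have cmin x y : clamp a b (Num.min x y) = Num.min (clamp a b x) (clamp a b y).
    by case: (leP x y) => [|/ltW] /(clamp_homo a b) h; rewrite ?(min_l h)// (min_r h).
  have cmax x y : clamp a b (Num.max x y) = Num.max (clamp a b x) (clamp a b y).
    by case: (leP x y) => [|/ltW] /(clamp_homo a b) h; rewrite ?(max_r h)// (max_l h).
  by rewrite cmin cmax.
- apply: le_lt_trans ld; rewrite /total_length big_map.
  rewrite big_seq [leRHS]big_seq; apply: ler_sum => p /(allP l12) p12.
  exact: clamp_lipschitz.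
Qed.

Lemma abs_cont_clamp_continuous a b (f : R -> R) : a <= b -> abs_cont a b f ->
  continuous (f \o clamp a b).
Proof.
move=> ab acf x; apply/cvgrPdist_lt => e e0.
have [d d0 H] := abs_cont_clamp _ _ _ ab acf _ e0.
near=> y.
have xyd : `|x - y| < d by near: y; apply: cvgr_dist_lt => //; exact: cvg_id.
have H1 (p : R * R) : p.1 <= p.2 -> p.2 - p.1 < d ->
    `|(f \o clamp a b) p.2 - (f \o clamp a b) p.1| < e.
  move=> p12 pd; have := H [:: p]; rewrite /increments /total_length !big_seq1.
  by apply; rewrite //= p12.
have [yx|xy] := leP y x.
  by apply: (H1 (y, x)) => //=; move: xyd; rewrite ger0_norm ?subr_ge0.
rewrite distrC; apply: (H1 (x, y)) => /=; first exact: ltW.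
by move: xyd; rewrite distrC ger0_norm// subr_ge0 ltW.
Unshelve. all: by end_near. Qed.

(** The density is the Radon-Nikodym derivative of the Stieltjes measure of the clamped function. *)
Lemma nondecreasing_abs_cont_density a b (f : R -> R) : a <= b ->
  abs_cont a b f -> {in `[a, b] &, nondecreasing_fun f} ->
  exists g : R -> R, mu.-integrable setT (EFin \o g) /\
    forall x, a <= x -> x <= b -> \int[mu]_(t in `[a, x]) g t = f x - f a.
Proof.
move=> ab acf ndf.
have nd : nondecreasing (f \o clamp a b).
  by move=> x y xy /=; apply: ndf; rewrite ?in_itv /= ?clamp_in//; exact: clamp_homo.
have rc : right_continuous (f \o clamp a b).
  exact/right_continuousW/abs_cont_clamp_continuous.
pose h : cumulative R R := HB.pack (f \o clamp a b)
  (isCumulative.Build R _ R (f \o clamp a b) nd rc).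
(* Restricting to []a, b]] yields a finite measure, as required for an integrable density. *)
pose D : set (measurableTypeR R) := `]a, b]%classic.
have mD : measurable D by exact: measurable_itv.
have hD : (lebesgue_stieltjes_measure h D < +oo)%E.
  by rewrite lebesgue_stieltjes_itvoc// ltry.
pose nu : {finite_measure set (measurableTypeR R) -> \bar R} := mfrestr mD hD.
have nu_mu : nu `<< mu.
  have := lebesgue_stieltjes_dominates h (abs_cont_clamp _ _ _ ab acf).
  move=> /null_content_dominatesP dom; apply/null_content_dominatesP => A mA A0.
  apply/eqP; rewrite eq_le measure_ge0 andbT -(dom _ mA A0).
  rewrite /nu /= /mfrestr /mrestr le_measure ?inE//; exact: measurableI.
have [g [g0 gfin intg nuE]] := radon_nikodym_sigma_finite nu_mu.
have gE : EFin \o (fine \o g) = g by apply/funext => x /=; rewrite fineK.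
exists (fine \o g); split; first by rewrite gE.
move=> x ax xb.
(* Dropping the null point [a] leaves []a, x]], whose Stieltjes mass is the increment of [f]. *)
rewrite -Rintegral_itv_obnd_cbnd; last first.
  rewrite gE; apply: (integrableS _ _ _ intg) => //.
rewrite /Rintegral (eq_integral g); last by move=> t _ /=; rewrite fineK.
rewrite -nuE; last exact: measurable_itv.
rewrite /nu /= /mfrestr /mrestr (_ : _ `&` D = `]a, x]%classic); last first.
  apply/seteqP; split => z /=; rewrite /D /= !in_itv /=; first by case.
  by move=> /andP[az zx]; rewrite az zx (le_trans zx).
by rewrite lebesgue_stieltjes_itvoc//= !clamp_id.
Qed.

Lemma abs_cont_density a b (f : R -> R) : a <= b -> abs_cont a b f ->
  exists g : R -> R, mu.-integrable setT (EFin \o g) /\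
    forall x, a <= x -> x <= b -> \int[mu]_(t in `[a, x]) g t = f x - f a.
Proof.
move=> ab acf; have acV := abs_cont_variation_fun _ _ _ acf.
have [g [intg gE]] := nondecreasing_abs_cont_density _ _ _ ab acV
  (variation_fun_nondecreasing _ _ _ acf).
have [k [intk kE]] := nondecreasing_abs_cont_density _ _ _ ab
  (abs_contB _ _ _ _ acV acf) (variation_funB_nondecreasing _ _ _ acf).
exists (g \- k); split.
  rewrite (_ : EFin \o _ = (EFin \o g) \- (EFin \o k))%E//.
  exact: integrableB.
move=> x ax xb; rewrite RintegralB//; first by rewrite gE// kE//=; ring.
- exact: integrableS intg.
- exact: integrableS intk.
Qed.

(** Almost every point is a point where the indefinite integral of [g] has derivative [g]. The open
    interval matters: the derivative of [f] at an endpoint depends on its values outside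
    [[a, b]]. *)
Lemma abs_cont_ae_derive1 a b (f : R -> R) : a <= b -> abs_cont a b f ->
  exists g : R -> R, [/\ mu.-integrable setT (EFin \o g),
    forall x, a <= x -> x <= b -> \int[mu]_(t in `[a, x]) g t = f x - f a &
    {ae mu, forall x, x \in `]a, b[ -> derive1 f x = g x}].
Proof.
move=> ab acf; have [g [intg gE]] := abs_cont_density _ _ _ ab acf.
exists g; split => //.
have intS (A : set R) : measurable (A : set (measurableTypeR R)) ->
    mu.-integrable A (EFin \o g).
  by move=> mA; exact: integrableS intg.
have := @FTC1 R g (BLeft a) (fun y => intS _ (measurable_itv _)).
have locg : locally_integrable [set: R] g.
  by apply: open_integrable_locally => //; exact: openT.
move=> /(_ locg) /=; apply: filterS; first exact: (ae_filter_ringOfSetsType mu).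
move=> x.
move=> H; rewrite in_itv /= => /andP[ax xb].
pose F y := \int[mu]_(t in `[a, y]) g t.
have [dF <-] : derivable F x 1 /\ derive1 F x = g x by apply: H; rewrite lte_fin.
(* Adding the constant [f a] to [F] gives a function equal to [f] near [x], with the same derivative
   as [F]. *)
rewrite !derive1E -[RHS]addr0 -(derive_cst (f a) x 1) -deriveD//.
apply: near_eq_derive; near=> y => /=.
have ya : a < y by near: y; exact: lt_nbhsr.
have yb : y < b by near: y; exact: lt_nbhsl.
by rewrite fctE /F gE ?ltW// /cst subrK.
Unshelve. all: by end_near. Qed.

End density.

(** * Bounds in the Cameron-Martin space *)

Section H01_bounds.
Context {R : realType}.
Notation mu := (@lebesgue_measure R).
Implicit Types (T : R) (f : R -> R).

Lemma integrable_itvS (i : interval R) (D : set R) (g : R -> \bar R) :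
  measurable (D : set (measurableTypeR R)) -> [set` i] `<=` D ->
  mu.-integrable D g -> mu.-integrable [set` i] g.
Proof. by move=> mD iD; apply: integrableS => //; exact: measurable_itv. Qed.

Lemma ge0_le_Rintegral_itvS (i : interval R) (D : set R) (g : R -> R) :
  measurable (D : set (measurableTypeR R)) -> [set` i] `<=` D ->
  mu.-integrable D (EFin \o g) -> (forall t, 0 <= g t) ->
  \int[mu]_(t in [set` i]) g t <= \int[mu]_(t in D) g t.
Proof.
move=> mD iD intg g0; rewrite /Rintegral fine_le//.
- by refine (integrable_fin_num _ (integrable_itvS i D _ mD iD intg)).
- exact: integrable_fin_num.
- apply: ge0_subset_integral => //; first exact: measurable_int intg.
  by move=> t _; rewrite lee_fin.
Qed.

Lemma integrable_cst_itv (a b c : R) : mu.-integrable `[a, b] (EFin \o (fun=> c)).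
Proof.
apply: continuous_compact_integrable; first exact: segment_compact.
by apply: continuous_subspaceT => x; exact: cvg_cst.
Qed.

Lemma H01_integrable_derive1_sqr T f : H01 T f ->
  mu.-integrable `[0, T] (EFin \o (fun t => derive1 f t ^+ 2)).
Proof.
move=> [_ _ /Lfun2_integrable_sqr int2].
have := integrable_itvS `[0, T] _ _ measurableT (@subsetT _ _) int2.
apply: eq_integrable => // t tT /=.
by rewrite patchE tT.
Qed.

(** On a bounded interval square integrability implies integrability, as [|f'| <= f'^2 + 1]. *)
Lemma H01_integrable_derive1 T f : H01 T f ->
  mu.-integrable `[0, T] (EFin \o derive1 f).
Proof.
move=> fH; have [_ _] := fH; rewrite inE => /andP[+ _]; rewrite inE /= => mf.
have m' : measurable_fun (`[0, T] : set (measurableTypeR R)) (derive1 f).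
  have := @measurable_funTS _ _ _ _ `[0, T]%classic _ mf.
  apply: eq_measurable_fun => t tT.
  by rewrite patchE tT.
apply: (@le_integrable _ _ _ mu _ _ _ (EFin \o (fun t => derive1 f t ^+ 2 + 1))) => //.
- exact/measurable_EFinP.
- move=> t _ /=; rewrite lee_fin [leRHS]ger0_norm; last by rewrite addr_ge0// sqr_ge0.
  by rewrite -real_normK ?num_real//; nra.
- exact: (integrableD _ (H01_integrable_derive1_sqr _ _ fH)
    (integrable_cst_itv _ _ 1)).
Qed.

Lemma H01_integral_derive1 T f x : H01 T f -> 0 <= x -> x <= T ->
  f x = \int[mu]_(t in `[0, x]) derive1 f t.
Proof.
move=> fH x0 xT; have T0 := le_trans x0 xT; have [acf f0 _] := fH.
have [g [intg gE aeg]] :=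
  abs_cont_ae_derive1 _ _ _ T0 (absolutely_continuous_on_abs_cont _ _ _ acf).
have := gE x x0 xT; rewrite f0 subr0 => <-; rewrite /Rintegral; congr fine.
(* The equality of [g] and [derive1 f] is known only inside []0, T[], so the two endpoints are
   discarded as a null set. *)
have ends : {ae mu, forall t, t != 0 /\ t != T}.
  exists [set 0; T]; split.
  - by apply: measurableU; exact: measurable_set1.
  - exact/countable_lebesgue_measure0/finite_set_countable/finite_set2.
  - move=> t /= /not_andP[] /negP; rewrite negbK => /eqP ->; [by left|by right].

apply: ae_eq_integral.
- exact: measurable_itv.
- exact: measurable_int (integrable_itvS `[0, x] _ _ measurableT (@subsetT _ _) intg).
- apply: measurable_int (integrable_itvS `[0, x] _ _ (measurable_itv `[0, T]) _
    (H01_integrable_derive1 _ _ fH)).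
  by apply: subset_itvl; rewrite bnd_simp.
- apply: (@filterS2 _ _ (ae_filter_ringOfSetsType mu)) aeg ends => t /= gt [t0 tT].
  rewrite in_itv /= => /andP[t0' tx].
  rewrite gt// in_itv /= lt_neqAle eq_sym t0 t0' /=.
  by rewrite lt_neqAle tT (le_trans tx).
Qed.

(** Young's inequality [2 |f'| <= f'^2 / c + c], integrated; the weight [c] stays free to be tuned
    later. *)
Lemma H01_norm_le T f x c : H01 T f -> 0 <= x -> x <= T -> 0 < c ->
  2 * `|f x| <= (\int[mu]_(t in `[0, T]) derive1 f t ^+ 2) / c + c * T.
Proof.
move=> fH x0 xT c0; have T0 := le_trans x0 xT.
have sub : `[0, x]%classic `<=` `[0, T]%classic.
  by apply: subset_itvl; rewrite bnd_simp.
have muT : fine (mu `[0, T]%classic) = T.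
  rewrite lebesgue_measure_itv /= lte_fin; case: ltP => /=; first by rewrite oppr0 addr0.
  by move=> T0'; apply/eqP; rewrite eq_le T0.
have int1 := H01_integrable_derive1 _ _ fH.
have int2 := H01_integrable_derive1_sqr _ _ fH.
have intx := integrable_itvS `[0, x] _ _ (measurable_itv `[0, T]) sub int1.
have int2' : mu.-integrable `[0, T] (EFin \o (fun t => derive1 f t ^+ 2 / c)).
  rewrite (_ : EFin \o _ = (fun t => (c^-1)%:E * (derive1 f t ^+ 2)%:E)%E).
    exact: integrableZl.
  by apply/funext => t /=; rewrite mulrC.
have intc := integrable_cst_itv 0 T c.
have int3 : mu.-integrable `[0, T] (EFin \o (fun t => derive1 f t ^+ 2 / c + c)).
  exact: (integrableD _ int2' intc).
have int1n : mu.-integrable `[0, T] (EFin \o (fun t => 2 * `|derive1 f t|)).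
  rewrite (_ : EFin \o _ = (fun t => 2%:E * (abse \o (EFin \o derive1 f)) t)%E)//.
  by apply: integrableZl => //; exact: integrable_abse.
apply: (@le_trans _ _ (\int[mu]_(t in `[0, T]) (2 * `|derive1 f t|))).
  rewrite (H01_integral_derive1 T f x)//.
  rewrite RintegralZl//; last exact: integrable_norm.
  rewrite ler_pM2l//; apply: (le_trans (le_normr_Rintegral _ intx)) => //.
  by apply: ge0_le_Rintegral_itvS => //; exact: integrable_norm.
apply: (@le_trans _ _ (\int[mu]_(t in `[0, T]) (derive1 f t ^+ 2 / c + c))).
  apply: le_Rintegral => // t _.
  (* Expanding this weighted square gives exactly the difference of the two sides. *)
  have : 0 <= (`|derive1 f t| / c - 1) ^+ 2 * c by rewrite mulr_ge0 ?sqr_ge0 ?ltW.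
  rewrite -[derive1 f t ^+ 2]real_normK ?num_real//.
  rewrite (_ : _ * c = `|derive1 f t| ^+ 2 / c + c - 2 * `|derive1 f t|).
    by lra.
  by field; rewrite gt_eqF.
rewrite RintegralD//  RintegralZr// Rintegral_cst//.
by apply: lerD => //; rewrite -[in leRHS]muT.
Qed.

Lemma integral_expRN T : 0 < T ->
  \int[mu]_(t in `[0, T]) expR (- t) = 1 - expR (- T).
Proof.
move=> T0; have cE : continuous (fun t : R => expR (- t)).
  by move=> t; apply: continuous_comp; [exact: opp_continuous|exact: continuous_expR].
have dF (t : R) : is_derive t 1 (fun t => - expR (- t)) (expR (- t)).
  have -> : expR (- t) = - (expR (- t) * -1) by rewrite mulrN1 opprK.
  apply: is_deriveN; apply: is_derive1_comp.
have cF : continuous (fun t : R => - expR (- t)).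
  by move=> t; apply: (continuous_comp (cE t)); exact: opp_continuous.
rewrite /Rintegral (@continuous_FTC2 _ _ (fun t => - expR (- t)) _ _ T0)/=.
- by rewrite oppr0 expR0 opprK addrC.
- exact: continuous_subspaceT.
- split; first by move=> t _; have [] := dF t.
  + exact/cvg_at_right_filter/cF.
  + exact/cvg_at_left_filter/cF.
- by move=> t _; rewrite derive1E; have [] := dF t.
Qed.

End H01_bounds.

(** * The rate functional *)

Section rate.
Context {R : realType}.
Notation mu := (@lebesgue_measure R).
Implicit Types (T : R) (f : R -> R).

Lemma H01_cst0 T : H01 T (cst 0 : R -> R).
Proof.
split => //.
- move=> e e0; exists 1 => // n u v _ _ _.
  by rewrite big1// => i _; rewrite subrr normr0.
- rewrite (_ : _ \_ _ = cst 0); last first.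
    by apply/funext => t; rewrite patchE derive1_cst; case: ifP.
  have p1 : (1 <= (2%:R)%:E :> \bar R)%E by rewrite lee_fin ler1n.
  exact: (@rpred0 _ (Lfun mu (2%:R)%:E)).
Qed.

(** Only the clamped function is known to be continuous on the whole line; it agrees with [f] on
    [[0, T]]. *)
Lemma integrable_exp_H01 T f : 0 <= T -> H01 T f ->
  mu.-integrable `[0, T] (EFin \o (fun t => expR (- t + 2 * f t))).
Proof.
move=> T0 [/absolutely_continuous_on_abs_cont acf _ _].
have cf := abs_cont_clamp_continuous _ _ _ T0 acf.
have : mu.-integrable `[0, T] (EFin \o (fun t => expR (- t + 2 * (f \o clamp 0 T) t))).
  apply: continuous_compact_integrable; first exact: segment_compact.
  apply: continuous_subspaceT => t.
  apply: continuous_comp; last exact: continuous_expR.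
  apply: cvgD; first exact: opp_continuous.
  by apply: cvgM; [exact: cvg_cst|exact: cf].
apply: eq_integrable => [|t]; first exact: measurable_itv.
by rewrite inE /= in_itv /= => /andP[t0 tT]; rewrite clamp_id.
Qed.

(** Taking [c := a] in [H01_norm_le] gives [E] the coefficient 1 in [a * M], so the energy cancels
    whatever its size and the bound is uniform in [f]. *)
Lemma rate_functional_ge T k f (a := k ^+ 2 / (1 - expR (- T))) :
  0 < T -> 0 < k -> H01 T f -> a * (1 - a * T) <= rate_functional T k f.
Proof.
move=> T0 k0 fH.
have D0 : 0 < 1 - expR (- T) by rewrite subr_gt0 expR_lt1 oppr_lt0.
have a0 : 0 < a by rewrite divr_gt0// exprn_gt0.
rewrite /rate_functional.
set J := \int[mu]_(t in _) expR _; set E := \int[mu]_(t in _) _ ^+ 2.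
pose M := E / a + a * T.
have fM t : 0 <= t -> t <= T -> 2 * `|f t| <= M.
  by move=> t0 tT; exact: H01_norm_le.
have intJ := integrable_exp_H01 _ _ (ltW T0) fH.
have intN : mu.-integrable `[0, T] (EFin \o (fun t => expR (- t))).
  apply: continuous_compact_integrable; first exact: segment_compact.
  apply: continuous_subspaceT => t.
  by apply: continuous_comp; [exact: opp_continuous|exact: continuous_expR].
have muE c : \int[mu]_(t in `[0, T]) (c * expR (- t)) = c * (1 - expR (- T)).
  by rewrite RintegralZl// integral_expRN.
have intNc c : mu.-integrable `[0, T] (EFin \o (fun t => c * expR (- t))).
  rewrite (_ : EFin \o _ = (fun t => c%:E * (expR (- t))%:E)%E)//.
  exact: integrableZl.
have JM : J <= expR M * (1 - expR (- T)).
  rewrite -muE; apply: le_Rintegral => // t /=; rewrite in_itv /= => /andP[t0 tT].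
  rewrite -expRD ler_expR addrC lerD2r.
  by apply: le_trans (fM t t0 tT); rewrite ler_pM2l// ler_norm.
(* Positivity of [J] excludes the default value of division by zero and allows [JM] to be
   inverted. *)
have J0 : 0 < J.
  apply: (@lt_le_trans _ _ (expR (- M) * (1 - expR (- T)))).
    by rewrite mulr_gt0// expR_gt0.
  rewrite -muE; apply: le_Rintegral => // t /=; rewrite in_itv /= => /andP[t0 tT].
  rewrite -expRD ler_expR addrC lerD2l.
  by have := fM t t0 tT; have := lerNnormlW (lexx `|f t|); lra.
have kJ : a * expR (- M) <= k ^+ 2 / J.
  rewrite /a (expRN M) -mulrA -invfM ler_pM2l ?exprn_gt0// lef_pV2 ?posrE//.
    by rewrite mulrC.
  by rewrite mulr_gt0// expR_gt0.
have := expR_ge1Dx (- M); rewrite -(ler_pM2l a0) => aM.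
have -> : a * (1 - a * T) = a * (1 - M) + E.
  by rewrite /M; field; rewrite gt_eqF.
lra.
Qed.

Lemma rate_functional_cst0 T k : 0 < T ->
  rate_functional T k (cst 0) = k ^+ 2 / (1 - expR (- T)).
Proof.
move=> T0; rewrite /rate_functional.
rewrite (@eq_Rintegral _ _ _ mu _ (fun t => expR (- t))); last first.
  by move=> t _ /=; rewrite mulr0 addr0.
rewrite integral_expRN// (@eq_Rintegral _ _ _ mu _ (fun=> 0)); last first.
  by move=> t _ /=; rewrite derive1_cst expr0n.
by rewrite Rintegral_cst// mul0r addr0.
Qed.

End rate.

Theorem theorem8p21 (R : realType) (T k : R) (T_gt0 : 0 < T) (k_gt0 : 0 < k)
    (k_lt : k < Num.sqrt ((1 - expR (- T)) / (2 * T * expR 1))) :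
  k ^+ 2 * (expR 1 - 1) / (2 * expR 1 * (1 - expR (- T))) <= toy_rate T k
  /\ toy_rate T k <= k ^+ 2 / (1 - expR (- T)).
Proof.
have D0 : 0 < 1 - expR (- T) by rewrite subr_gt0 expR_lt1 oppr_lt0.
have e0 : 0 < expR 1 :> R := expR_gt0 1.
set a := k ^+ 2 / (1 - expR (- T)).
have a0 : 0 < a by rewrite divr_gt0// exprn_gt0.
(* This is the hypothesis on [k], squared and divided by [1 - expR (- T)]. *)
have aT : a * T < (2 * expR 1)^-1.
  have : k ^+ 2 < (1 - expR (- T)) / (2 * T * expR 1).
    rewrite -[ltRHS]sqr_sqrtr; last by rewrite divr_ge0 ?mulr_ge0 ?ltW.
    by rewrite ltr_pXn2r ?nnegrE ?sqrtr_ge0 ?ltW.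
  rewrite ltr_pdivlMr ?mulr_gt0// => h.
  rewrite -[ltRHS]mul1r ltr_pdivlMr ?mulr_gt0//.
  rewrite (_ : a * T * _ = k ^+ 2 * (2 * T * expR 1) / (1 - expR (- T))).
    by rewrite ltr_pdivrMr// mul1r.
  by rewrite /a; field; rewrite gt_eqF.
pose S := [set rate_functional T k f | f in H01 T].
have S0 : S a by exists (cst 0); [exact: H01_cst0|exact: rate_functional_cst0].
have Sge : lbound S (a * (1 - a * T)).
  by move=> _ [f fH <-]; exact: rate_functional_ge.
have infle : inf S <= a by apply: ge_inf S0; exists (a * (1 - a * T)).
have infge : a * (1 - a * T) <= inf S by apply: lb_le_inf => //; exists a.
(* The value at zero gives [a / 2] for the upper bound, and [a / 2 <= a] because [a] is positive. *)
rewrite /toy_rate -/S; split; last by lra.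
have -> : k ^+ 2 * (expR 1 - 1) / (2 * expR 1 * (1 - expR (- T))) =
    2^-1 * (a * (1 - (expR 1)^-1)).
  by rewrite /a; field; rewrite !gt_eqF.
(* It remains to see that [a * T] is at most the inverse of [expR 1]; it is even below half of
   that. *)
rewrite ler_pM2l//; apply: le_trans infge; rewrite ler_pM2l//.
rewrite lerD2l lerN2 (le_trans (ltW aT))// lef_pV2 ?posrE ?mulr_gt0//.
by lra.
Qed.
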